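(* Let $\mathsf{X}$ be a subshift over an alphabet $\mathscr{A}$ and let $R$ be a commutative unital ring. Then the homomorphism $\pi:\widetilde{\mathcal{A}}_R(\mathsf{X})\to \mathrm{End}_R(\mathbb{P})$ is faithful (injective) if and only if $\mathsf{X}$ has no cycle without exit.
   Context: $\mathbb{N}=\{0,1,2,\dots\}$. $\mathscr{A}$ is an arbitrary non-empty set (alphabet); $\sigma:\mathscr{A}^{\mathbb{N}}\to\mathscr{A}^{\mathbb{N}}$ is the shift $\sigma(x_1x_2x_3\dots)=x_2x_3\dots$. $\mathscr{A}^*$ is the set of finite words, including the empty word $\omega$. For $F\subseteq\mathscr{A}^*$, the subshift $\mathsf{X}=\mathsf{X}_F$ is the set of all sequences in $\mathscr{A}^{\mathbb{N}}$ no finite (contiguous) subword of which belongs to $F$. The language $\mathcal{L}_{\mathsf{X}}$ is the set of all finite words (including $\omega$) appearing in some element of $\mathsf{X}$. For $\alpha,\beta\in\mathcal{L}_{\mathsf{X}}$ let $C(\alpha,\beta)=\{\beta x\in\mathsf{X}:\alpha x\in\mathsf{X}\}$. $\mathcal{U}$ is the Boolean algebra of subsets of $\mathsf{X}$ generated by all $C(\alpha,\beta)$, $\alpha,\beta\in\mathcal{L}_{\mathsf{X}}$ (finite unions, finite intersections, complements in $\mathsf{X}$). For $A\in\mathcal{U}$ and $\alpha\in\mathcal{L}_{\mathsf{X}}$, the relative range is $r(A,\alpha)=\{x\in\mathsf{X}:\alpha x\in A\}$. The unital subshift algebra $\widetilde{\mathcal{A}}_R(\mathsf{X})$ is the universal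 unital $R$-algebra with generators $\{p_A:A\in\mathcal{U}\}$ and $\{s_a,s_a^*:a\in\mathscr{A}\}$ subject to: (i) $p_{\mathsf{X}}=1$, $p_{A\cap B}=p_Ap_B$, $p_{A\cup B}=p_A+p_B-p_{A\cap B}$, $p_\emptyset=0$ for all $A,B\in\mathcal{U}$; (ii) $s_as_a^*s_a=s_a$ and $s_a^*s_as_a^*=s_a^*$ for all $a\in\mathscr{A}$; (iii) $s_\beta s_\alpha^*s_\alpha s_\beta^*=p_{C(\alpha,\beta)}$ for all $\alpha,\beta\in\mathcal{L}_{\mathsf{X}}$, where $s_\omega=s_\omega^*=1$ and, for $\alpha=\alpha_1\cdots\alpha_n\in\mathcal{L}_{\mathsf{X}}$, $s_\alpha=s_{\alpha_1}\cdots s_{\alpha_n}$, $s_\alpha^*=s_{\alpha_n}^*\cdots s_{\alpha_1}^*$. $\mathbb{P}$ is the free $R$-module with basis $\{\delta_x:x\in\mathsf{X}\}$, and $\mathrm{End}_R(\mathbb{P})$ is the $R$-algebra of its $R$-endomorphisms. For a statement $p$, $[p]=1$ if $p$ is true and $[p]=0$ otherwise. $\pi:\widetilde{\mathcal{A}}_R(\mathsf{X})\to\mathrm{End}_R(\mathbb{P})$ is the $R$-algebra homomorphism with $\pi(p_A)=P_A$, $\pi(s_a)=S_a$, $\pi(s_a^* )=S_a^*$ for $A\in\mathcal{U}$, $a\in\mathscr{A}$, where for $x=x_1x_2x_3\dots\in\mathsf{X}$: $P_A(\delta_x)=[x\in A]\,\delta_x$, $S_a(\delta_x)=[ax\in\mathsf{X}]\,\delta_{ax}$,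 $S_a^*(\delta_x)=[x_1=a]\,\delta_{\sigma(x)}$ (the value being $0$ when the bracket is $0$). For a nonempty finite word $c$, $c^\infty$ denotes the infinite word $ccc\cdots$. A cycle is a pair $(A,c)$ with $\emptyset\neq A\in\mathcal{U}$ and $c\in\mathcal{L}_{\mathsf{X}}$, $c\neq\omega$, such that $A\subseteq r(A,c)$. The cycle $(A,c)$ has no exit (is a cycle without exit) if $A=\{c^\infty\}$.
   Formalization: The ring R is assumed non-zero and, if X is non-empty, every letter of the alphabet is assumed to occur in X; otherwise the claim fails (R = 0 with a cycle without exit; or an unused letter b, where s_b is non-zero but π(s_b) = 0). *)

(* Defs.v *)
From HB Require Import structures.
From mathcomp Require Import all_boot all_order all_algebra.
From mathcomp Require Import all_classical.
From mathcomp Require Import finmap monalg.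

Set Implicit Arguments.
Unset Strict Implicit.
Unset Printing Implicit Defensive.

Import GRing.Theory.

Local Open Scope classical_set_scope.
Local Open Scope quotient_scope.
Local Open Scope ring_scope.

(* Associative unital R-algebras, given by a ring morphism from R to the
   center.  MathComp's [algType] cannot be used: it requires 1 != 0, whereas
   the algebra of the empty subshift is the zero algebra. *)
HB.mixin Record PzRing_isUAlgebra (R : comNzRingType) B of GRing.PzRing B := {
  scal : R -> B;
  scalD : forall a b : R, scal (a + b) = scal a + scal b;
  scalM : forall a b : R, scal (a * b) = scal a * scal b;
  scal1 : scal 1 = 1;
  scalC : forall (a : R) (u : B), scal a * u = u * scal a
}.

#[short(type="ualgType")]
HB.structure Definition UAlgebra (R : comNzRingType) :=
  {B of GRing.PzRing B & PzRing_isUAlgebra R B}.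

Definition ualg_morphism (R : comNzRingType) (A B : ualgType R) (f : A -> B) :=
  [/\ forall u v, f (u + v) = f u + f v,
      forall u v, f (u * v) = f u * f v
    & forall a, f (scal a) = scal a].

Section Endomorphisms.
Variables (R : comNzRingType) (V : lmodType R).

Definition endo : Type := {linear V -> V}.

HB.instance Definition _ := gen_eqMixin endo.
HB.instance Definition _ := gen_choiceMixin endo.

Definition endo_fun (f : endo) : V -> V := f : {linear V -> V}.
Coercion endo_fun : endo >-> Funclass.

HB.instance Definition _ (f : endo) :=
  GRing.Linear.copy (endo_fun f) (f : {linear V -> V}).

Lemma endoP (f g : endo) : f =1 g -> f = g.
Proof.
rewrite /endo_fun => /funext.
case: f g => [f cf] [g cg] /= efg.
case: _ / efg cg => cg.
congr GRing.Linear.Pack.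
case: cf cg => [[a1] [a2]] [[b1] [b2]].
by congr GRing.Linear.Class;
  [congr GRing.isNmodMorphism.Axioms_ | congr GRing.isScalable.Axioms_];
  exact: Prop_irrelevance.
Qed.

Definition endo0 : endo := (\0 : V -> V) : {linear V -> V}.
Definition endo1 : endo := (idfun : V -> V) : {linear V -> V}.
Definition endoN (f : endo) : endo := (\- f) : {linear V -> V}.
Definition endoD (f g : endo) : endo := (f \+ g) : {linear V -> V}.
Definition endoM (f g : endo) : endo := (f \o g) : {linear V -> V}.
Definition endo_scal (a : R) : endo := (a \*: idfun : V -> V) : {linear V -> V}.

Fact endo_addA : associative endoD.
Proof. by move=> f g h; apply: endoP => v; exact: addrA. Qed.
Fact endo_addC : commutative endoD.
Proof. by move=> f g; apply: endoP => v; exact: addrC. Qed.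
Fact endo_add0 : left_id endo0 endoD.
Proof. by move=> f; apply: endoP => v; exact: add0r. Qed.
Fact endo_addN : left_inverse endo0 endoN endoD.
Proof. by move=> f; apply: endoP => v; exact: addNr. Qed.

HB.instance Definition _ :=
  GRing.isZmodule.Build endo endo_addA endo_addC endo_add0 endo_addN.

Fact endo_mulA : associative endoM.
Proof. by move=> f g h; apply: endoP. Qed.
Fact endo_mul1l : left_id endo1 endoM.
Proof. by move=> f; apply: endoP. Qed.
Fact endo_mul1r : right_id endo1 endoM.
Proof. by move=> f; apply: endoP. Qed.
Fact endo_mulDl : left_distributive endoM +%R.
Proof. by move=> f g h; apply: endoP. Qed.
Fact endo_mulDr : right_distributive endoM +%R.
Proof. by move=> f g h; apply: endoP => v; exact: raddfD. Qed.

HB.instance Definition _ :=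
  GRing.Zmodule_isPzRing.Build endo
    endo_mulA endo_mul1l endo_mul1r endo_mulDl endo_mulDr.

Fact endo_scalD (a b : R) : endo_scal (a + b) = endo_scal a + endo_scal b.
Proof. by apply: endoP => v; exact: scalerDl. Qed.
Fact endo_scalM (a b : R) : endo_scal (a * b) = endo_scal a * endo_scal b.
Proof. by apply: endoP => v; rewrite /= -[RHS]/(a *: (b *: v)) scalerA. Qed.
Fact endo_scal1 : endo_scal 1 = 1.
Proof. by apply: endoP => v; exact: scale1r. Qed.
Fact endo_scalC (a : R) (f : endo) : endo_scal a * f = f * endo_scal a.
Proof. by apply: endoP => v; rewrite -[RHS]/(f (a *: v)) linearZ. Qed.

HB.instance Definition _ :=
  PzRing_isUAlgebra.Build R endo endo_scalD endo_scalM endo_scal1 endo_scalC.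

Lemma endo_addE (f g : endo) v : (f + g) v = f v + g v. Proof. by []. Qed.
Lemma endo_mulE (f g : endo) v : (f * g) v = f (g v). Proof. by []. Qed.
Lemma endo_scalE (a : R) v : (scal a : endo) v = a *: v. Proof. by []. Qed.

End Endomorphisms.

(* The universal unital R-algebra on generators G subject to the relations
   t = u for rel t u: formal polynomial expressions in noncommuting generators,
   modulo the least congruence that contains rel and the algebra axioms. *)
Inductive alg_term (R G : Type) : Type :=
| TGen of G
| TCst of R
| TAdd of alg_term R G & alg_term R G
| TMul of alg_term R G & alg_term R G.

Arguments TGen {R G}.
Arguments TCst {R G}.

Section Presentation.
Variables (R : comNzRingType) (G : Type).
Local Notation term := (alg_term R G).
Variable rel : term -> term -> Prop.

Inductive alg_cong : term -> term -> Prop :=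
| cong_rel t u : rel t u -> alg_cong t u
| cong_refl t : alg_cong t t
| cong_sym t u : alg_cong t u -> alg_cong u t
| cong_trans u t v : alg_cong t u -> alg_cong u v -> alg_cong t v
| cong_add t t' u u' :
    alg_cong t t' -> alg_cong u u' -> alg_cong (TAdd t u) (TAdd t' u')
| cong_mul t t' u u' :
    alg_cong t t' -> alg_cong u u' -> alg_cong (TMul t u) (TMul t' u')
| cong_addA t u v : alg_cong (TAdd t (TAdd u v)) (TAdd (TAdd t u) v)
| cong_addC t u : alg_cong (TAdd t u) (TAdd u t)
| cong_add0 t : alg_cong (TAdd (TCst 0) t) t
| cong_addN t : alg_cong (TAdd (TMul (TCst (-1)) t) t) (TCst 0)
| cong_mulA t u v : alg_cong (TMul t (TMul u v)) (TMul (TMul t u) v)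
| cong_mul1l t : alg_cong (TMul (TCst 1) t) t
| cong_mul1r t : alg_cong (TMul t (TCst 1)) t
| cong_mulDl t u v : alg_cong (TMul (TAdd t u) v) (TAdd (TMul t v) (TMul u v))
| cong_mulDr t u v : alg_cong (TMul t (TAdd u v)) (TAdd (TMul t u) (TMul t v))
| cong_cstD a b : alg_cong (TCst (a + b)) (TAdd (TCst a) (TCst b))
| cong_cstM a b : alg_cong (TCst (a * b)) (TMul (TCst a) (TCst b))
| cong_cstC a t : alg_cong (TMul (TCst a) t) (TMul t (TCst a)).

HB.instance Definition _ := gen_eqMixin term.
HB.instance Definition _ := gen_choiceMixin term.

Definition alg_congb (t u : term) : bool := `[< alg_cong t u >].

Fact alg_congb_refl : reflexive alg_congb.
Proof. by move=> t; apply/asboolP; exact: cong_refl. Qed.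
Fact alg_congb_sym : symmetric alg_congb.
Proof. by move=> t u; apply/asboolP/asboolP => /cong_sym. Qed.
Fact alg_congb_trans : transitive alg_congb.
Proof.
move=> u t v /asboolP tu /asboolP uv; apply/asboolP; exact: cong_trans tu uv.
Qed.

Definition alg_equiv := EquivRel alg_congb alg_congb_refl alg_congb_sym
  alg_congb_trans.

Definition pres_alg : Type := {eq_quot alg_equiv}.

HB.instance Definition _ := Choice.on pres_alg.
HB.instance Definition _ := EqQuotient.on pres_alg.

Definition pres_class (t : term) : pres_alg := \pi_pres_alg t.

Lemma pres_classP t u : pres_class t = pres_class u <-> alg_cong t u.
Proof.
by split=> [/eqmodP/asboolP|tu] //; apply/eqmodP/asboolP.
Qed.

Lemma pres_repr (a : pres_alg) : pres_class (repr a) = a.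
Proof. exact: reprK. Qed.

Definition pres_gen (g : G) : pres_alg := pres_class (TGen g).
Definition pres_cst (a : R) : pres_alg := pres_class (TCst a).
Definition pres_add (a b : pres_alg) := pres_class (TAdd (repr a) (repr b)).
Definition pres_mul (a b : pres_alg) := pres_class (TMul (repr a) (repr b)).
Definition pres_opp (a : pres_alg) := pres_mul (pres_cst (-1)) a.

Lemma cong_repr t : alg_cong (repr (pres_class t)) t.
Proof. by apply/pres_classP; rewrite pres_repr. Qed.

Lemma pres_class_add t u :
  pres_class (TAdd t u) = pres_add (pres_class t) (pres_class u).
Proof.
by apply/pres_classP/cong_sym/cong_add; exact: cong_repr.
Qed.

Lemma pres_class_mul t u :
  pres_class (TMul t u) = pres_mul (pres_class t) (pres_class u).
Proof.
by apply/pres_classP/cong_sym/cong_mul; exact: cong_repr.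
Qed.

Local Ltac pres_ax c :=
  hnf; intros; repeat match goal with a : pres_alg |- _ =>
    rewrite -(pres_repr a); move: (repr a) => {}a end;
  rewrite /pres_opp /pres_cst -?(pres_class_add, pres_class_mul);
  apply/pres_classP; apply: c.

Fact pres_addA : associative pres_add. Proof. pres_ax cong_addA. Qed.
Fact pres_addC : commutative pres_add. Proof. pres_ax cong_addC. Qed.
Fact pres_add0 : left_id (pres_cst 0) pres_add. Proof. pres_ax cong_add0. Qed.
Fact pres_addN : left_inverse (pres_cst 0) pres_opp pres_add.
Proof. pres_ax cong_addN. Qed.

HB.instance Definition _ :=
  GRing.isZmodule.Build pres_alg pres_addA pres_addC pres_add0 pres_addN.

Fact pres_mulA : associative pres_mul. Proof. pres_ax cong_mulA. Qed.
Fact pres_mul1l : left_id (pres_cst 1) pres_mul. Proof. pres_ax cong_mul1l. Qed.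
Fact pres_mul1r : right_id (pres_cst 1) pres_mul.
Proof. pres_ax cong_mul1r. Qed.
Fact pres_mulDl : left_distributive pres_mul pres_add.
Proof. pres_ax cong_mulDl. Qed.
Fact pres_mulDr : right_distributive pres_mul pres_add.
Proof. pres_ax cong_mulDr. Qed.

HB.instance Definition _ :=
  GRing.Zmodule_isPzRing.Build pres_alg
    pres_mulA pres_mul1l pres_mul1r pres_mulDl pres_mulDr.

Fact pres_cstD a b : pres_cst (a + b) = pres_cst a + pres_cst b.
Proof. rewrite -[RHS]/(pres_add _ _); pres_ax cong_cstD. Qed.
Fact pres_cstM a b : pres_cst (a * b) = pres_cst a * pres_cst b.
Proof. rewrite -[RHS]/(pres_mul _ _); pres_ax cong_cstM. Qed.
Fact pres_cst1 : pres_cst 1 = 1. Proof. by []. Qed.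
Fact pres_cstC a (u : pres_alg) : pres_cst a * u = u * pres_cst a.
Proof.
rewrite -[LHS]/(pres_mul (pres_cst a) u) -[RHS]/(pres_mul u (pres_cst a)).
pres_ax cong_cstC.
Qed.

HB.instance Definition _ :=
  PzRing_isUAlgebra.Build R pres_alg pres_cstD pres_cstM pres_cst1 pres_cstC.

Section UniversalProperty.
Variables (B : ualgType R) (phi : G -> B).

Fixpoint alg_eval (t : term) : B :=
  match t with
  | TGen g => phi g
  | TCst a => scal a
  | TAdd t u => alg_eval t + alg_eval u
  | TMul t u => alg_eval t * alg_eval u
  end.

Definition satisfies := forall t u, rel t u -> alg_eval t = alg_eval u.

Lemma scal0 : scal 0 = 0 :> B.
Proof. by apply: (addrI (scal 0)); rewrite -scalD !addr0. Qed.

Lemma scalN1 : scal (-1) = -1 :> B.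
Proof. by apply: (addrI 1); rewrite -[X in X + _]scal1 -scalD !subrr scal0. Qed.

Lemma alg_eval_cong t u : satisfies -> alg_cong t u -> alg_eval t = alg_eval u.
Proof.
move=> phiP; elim=> {t u} //=.
- by move=> u t v _ -> _ ->.
- by move=> t t' u u' _ -> _ ->.
- by move=> t t' u u' _ -> _ ->.
- by move=> t u v; exact: addrA.
- by move=> t u; exact: addrC.
- by move=> t; rewrite scal0 add0r.
- by move=> t; rewrite scalN1 mulN1r addNr scal0.
- by move=> t u v; exact: mulrA.
- by move=> t; rewrite scal1 mul1r.
- by move=> t; rewrite scal1 mulr1.
- by move=> t u v; exact: mulrDl.
- by move=> t u v; exact: mulrDr.
- exact: scalD.
- exact: scalM.
- by move=> a t; exact: scalC.
Qed.

Definition pres_lift (x : pres_alg) : B := alg_eval (repr x).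

Lemma pres_lift_class t : satisfies -> pres_lift (pres_class t) = alg_eval t.
Proof. by move=> phiP; apply: alg_eval_cong => //; exact: cong_repr. Qed.

Lemma pres_lift_morphism : satisfies -> ualg_morphism pres_lift.
Proof.
move=> phiP; split=> [u v|u v|a]; last exact: pres_lift_class.
- exact: (pres_lift_class _ phiP).
- exact: (pres_lift_class _ phiP).
Qed.

Lemma pres_lift_gen g : satisfies -> pres_lift (pres_gen g) = phi g.
Proof. exact: pres_lift_class. Qed.

Lemma pres_lift_unique (f : pres_alg -> B) : satisfies ->
  ualg_morphism f -> (forall g, f (pres_gen g) = phi g) -> f =1 pres_lift.
Proof.
move=> phiP [fD fM fs] fg x; rewrite -(pres_repr x) pres_lift_class //.
elim: (repr x) => [g|a|t IHt u IHu|t IHt u IHu] /=.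
- exact: fg.
- exact: fs.
- by rewrite pres_class_add fD IHt IHu.
- by rewrite pres_class_mul fM IHt IHu.
Qed.

End UniversalProperty.

End Presentation.

Section FreeModule.
Variables (R : comNzRingType) (K : choiceType).
Local Notation P := {malg R[K]}.

Definition basis_vec (k : K) : P := << 1 *g k >>.

Definition basis_ext (f : K -> P) (g : P) : P :=
  \sum_(k <- msupp g) g@_k *: f k.

Lemma basis_extEw (f : K -> P) (d : {fset K}) g :
  fsubset (msupp g) d -> basis_ext f g = \sum_(k <- d) g@_k *: f k.
Proof.
move=> le; rewrite /basis_ext [LHS](big_fset_incl _ le) => //= x xd.
by move=> /mcoeff_outdom ->; rewrite scale0r.
Qed.

Fact basis_ext_linear (f : K -> P) : linear (basis_ext f).
Proof.
move=> a g h.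
pose d := fsetU (msupp (a *: g + h)) (fsetU (msupp g) (msupp h)).
rewrite !(@basis_extEw f d) /d.
- rewrite scaler_sumr -big_split; apply: eq_bigr => k _ /=.
  by rewrite mcoeffD mcoeffZ scalerDl scalerA.
- by rewrite fsetUA fsubsetUr.
- by rewrite fsetUCA fsubsetUl.
- exact: fsubsetUl.
Qed.

HB.instance Definition _ (f : K -> P) :=
  GRing.isLinear.Build R P P *:%R (basis_ext f) (basis_ext_linear f).

Definition basis_endo (f : K -> P) : endo P := basis_ext f : {linear P -> P}.

Lemma basis_endoE f k : basis_endo f (basis_vec k) = f k.
Proof.
rewrite -[LHS]/(basis_ext f _) (@basis_extEw f (fset1 k)).
  by rewrite big_seq_fset1 mcoeffUU scale1r.
exact: msuppU_le.
Qed.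

Lemma basis_endo_ext (f g : endo P) :
  (forall k, f (basis_vec k) = g (basis_vec k)) -> f = g.
Proof.
move=> fg; apply: endoP => v; rewrite (monalgE v) !linear_sum.
apply: eq_bigr => k _.
suff -> : << v@_k *g k >> = v@_k *: basis_vec k by rewrite !linearZ /= fg.
by apply/malgP => k'; rewrite mcoeffZ !mcoeffU mulr_natr.
Qed.

End FreeModule.

Section Sequences.
Variable L : pointedType.
Local Notation word := (seq L).
Local Notation infword := (nat -> L).

Definition shift (x : infword) : infword := fun n => x n.+1.

Definition prepend (a : L) (x : infword) : infword :=
  fun n => if n is m.+1 then x m else a.

Definition wcat (w : word) (x : infword) : infword := foldr prepend x w.

Definition factor (x : infword) (i n : nat) : word :=
  [seq x (i + k)%N | k <- iota 0 n].

(* Junk value for the empty word. *)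
Definition wpow (c : word) : infword := fun n => nth point c (n %% size c).

Variable F : set word.

Definition subshift : set infword := [set x | forall i n, ~ F (factor x i n)].

(* The disjunct makes the empty word belong to the language of the empty
   subshift as well. *)
Definition language : set word :=
  [set w | w = [::] \/
           exists2 x, subshift x & exists i, w = factor x i (size w)].

Definition relC (alpha beta : word) : set infword :=
  [set y | exists x, [/\ y = wcat beta x, subshift (wcat beta x)
                       & subshift (wcat alpha x)]].

Inductive in_boolalg : set infword -> Prop :=
| boolalg_C alpha beta :
    language alpha -> language beta -> in_boolalg (relC alpha beta)
| boolalg_U A B : in_boolalg A -> in_boolalg B -> in_boolalg (A `|` B)
| boolalg_I A B : in_boolalg A -> in_boolalg B -> in_boolalg (A `&` B)
| boolalg_D A : in_boolalg A -> in_boolalg (subshift `\` A).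

Definition rel_range (A : set infword) (alpha : word) : set infword :=
  [set x | subshift x /\ A (wcat alpha x)].

Definition is_cycle (A : set infword) (c : word) : Prop :=
  [/\ in_boolalg A, A !=set0, language c, c <> [::] & A `<=` rel_range A c].

Definition no_exit (A : set infword) (c : word) : Prop := A = [set wpow c].

Lemma relC0 : relC [::] [::] = subshift.
Proof. by apply/seteqP; split=> [y [x [-> //]]|y Xy]; exists y. Qed.

Lemma boolalg_X : in_boolalg subshift.
Proof. by rewrite -relC0; apply: boolalg_C; left. Qed.

Lemma boolalg_0 : in_boolalg set0.
Proof. by rewrite -(setDv subshift); exact/boolalg_D/boolalg_X. Qed.

Lemma subshift_shift x : subshift x -> subshift (shift x).
Proof. by move=> Xx i n; exact: (Xx i.+1 n). Qed.

Lemma shift_prepend a x : shift (prepend a x) = x.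
Proof. by []. Qed.

Lemma prepend_shift x : prepend (x 0%N) (shift x) = x.
Proof. by apply: funext => -[]. Qed.

Lemma wcat_inj w : injective (wcat w).
Proof.
elim: w => [//|a w IHw] x y /= /(congr1 shift).
by rewrite !shift_prepend => /IHw.
Qed.

Lemma subshift_prepend a x : subshift (prepend a x) -> subshift x.
Proof. by move/subshift_shift. Qed.

Lemma subshift_wcat w x : subshift (wcat w x) -> subshift x.
Proof. by elim: w => [//|a w IHw] /= /subshift_prepend. Qed.

End Sequences.

Section SubshiftAlgebra.
Variables (R : comNzRingType) (L : pointedType) (F : set (seq L)).
Local Notation X := (subshift F).
Local Notation infword := (nat -> L).

Definition boolalg := {A : set infword | in_boolalg F A}.

Definition bX : boolalg := exist _ X (boolalg_X F).
Definition b0 : boolalg := exist _ set0 (boolalg_0 F).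
Definition bI (A B : boolalg) : boolalg :=
  exist _ (sval A `&` sval B) (boolalg_I (svalP A) (svalP B)).
Definition bU (A B : boolalg) : boolalg :=
  exist _ (sval A `|` sval B) (boolalg_U (svalP A) (svalP B)).
Definition bC alpha beta (la : language F alpha) (lb : language F beta) :
  boolalg := exist _ (relC F alpha beta) (boolalg_C la lb).

Inductive generator :=
| gen_p of boolalg
| gen_s of L
| gen_s' of L. (* s_a^* *)

Local Notation term := (alg_term R generator).
Local Notation p_ A := (TGen (gen_p A) : term).
Local Notation s_ a := (TGen (gen_s a) : term).
Local Notation s'_ a := (TGen (gen_s' a) : term).
Local Notation "t '+t' u" := (TAdd t u) (at level 50, left associativity).
Local Notation "t '*t' u" := (TMul t u) (at level 40, left associativity).
Local Notation one := (TCst 1 : term).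

(* s_w and s_w^* *)
Definition sw (w : seq L) : term := foldr (fun a t => s_ a *t t) one w.
Definition sw' (w : seq L) : term := foldr (fun a t => t *t s'_ a) one w.

Inductive subshift_rel : term -> term -> Prop :=
| rel_pX : subshift_rel (p_ bX) one
| rel_p0 : subshift_rel (p_ b0) (TCst 0)
| rel_pI A B : subshift_rel (p_ (bI A B)) (p_ A *t p_ B)
| rel_pU A B :
    subshift_rel (p_ (bU A B)) (p_ A +t p_ B +t TCst (-1) *t p_ (bI A B))
| rel_ss's a : subshift_rel (s_ a *t s'_ a *t s_ a) (s_ a)
| rel_s'ss' a : subshift_rel (s'_ a *t s_ a *t s'_ a) (s'_ a)
| rel_C alpha beta (la : language F alpha) (lb : language F beta) :
    subshift_rel (sw beta *t sw' alpha *t sw alpha *t sw' beta)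
                 (p_ (bC la lb)).

Definition subshift_alg := pres_alg subshift_rel.

Definition subshift_mod := {malg R[X]}.

(* The basis vector at y if y is in X, and 0 otherwise. *)
Definition delta (y : infword) : subshift_mod :=
  if pselect (X y) is left Xy then basis_vec R (exist _ y (mem_set Xy)) else 0.

Definition iverson (P : Prop) : R := (`[< P >] : nat)%:R.

End SubshiftAlgebra.

(* Locked because comparing two of these operators up to conversion is very
   slow. *)
HB.lock Definition op_p (R : comNzRingType) (L : pointedType)
    (F : set (seq L)) (A : boolalg F) : endo (subshift_mod R F) :=
  basis_endo (fun x : subshift F =>
    iverson R (sval A (val x)) *: delta R F (val x)).

HB.lock Definition op_s (R : comNzRingType) (L : pointedType)
    (F : set (seq L)) (a : L) : endo (subshift_mod R F) :=
  basis_endo (fun x : subshift F =>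
    iverson R (subshift F (prepend a (val x)))
      *: delta R F (prepend a (val x))).

HB.lock Definition op_s' (R : comNzRingType) (L : pointedType)
    (F : set (seq L)) (a : L) : endo (subshift_mod R F) :=
  basis_endo (fun x : subshift F =>
    iverson R (val x 0%N = a) *: delta R F (shift (val x))).

Section Representation.
Variables (R : comNzRingType) (L : pointedType) (F : set (seq L)).
Local Notation X := (subshift F).
Local Notation infword := (nat -> L).
Local Notation boolalg := (boolalg F).
Local Notation generator := (generator F).
Local Notation term := (alg_term R generator).
Local Notation delta := (delta R F).
Local Notation iverson := (iverson R).
Local Notation subshift_mod := (subshift_mod R F).
Local Notation subshift_alg := (subshift_alg R F).
Local Notation subshift_rel := (@subshift_rel R L F).
Local Notation op_p := (@op_p R L F).
Local Notation op_s := (@op_s R L F).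
Local Notation op_s' := (@op_s' R L F).
Local Notation sw := (@sw R L F).
Local Notation sw' := (@sw' R L F).
Local Notation bX := (bX F).
Local Notation b0 := (b0 F).

Definition op_gen (g : generator) : endo subshift_mod :=
  match g with
  | gen_p A => op_p A
  | gen_s a => op_s a
  | gen_s' a => op_s' a
  end.

Definition subshift_pi : subshift_alg -> endo subshift_mod :=
  pres_lift op_gen.

Lemma iversonT (P : Prop) : P -> iverson P = 1.
Proof. by move=> h; rewrite /iverson asboolT. Qed.

Lemma iversonF (P : Prop) : ~ P -> iverson P = 0.
Proof. by move=> h; rewrite /iverson asboolF. Qed.

Lemma delta_val (x : X) : delta (val x) = basis_vec R x.
Proof.
rewrite /delta; case: pselect => [Xx|]; last by case; exact: set_valP.
by congr basis_vec; apply: val_inj.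
Qed.

Lemma delta_out y : ~ X y -> delta y = 0.
Proof. by rewrite /delta; case: pselect. Qed.

Lemma delta_ext (f g : endo subshift_mod) :
  (forall y, X y -> f (delta y) = g (delta y)) -> f = g.
Proof.
move=> fg; apply: basis_endo_ext => x; rewrite -delta_val; apply: fg.
exact: set_valP.
Qed.

Lemma op_pE A y : op_p A (delta y) = iverson (sval A y) *: delta y.
Proof.
case: (pselect (X y)) => [Xy|nXy]; last by rewrite delta_out // linear0 scaler0.
rewrite op_p.unlock.
by rewrite -[y]/(val (exist _ y (mem_set Xy) : X)) {1}delta_val basis_endoE.
Qed.

Lemma op_sE a y : op_s a (delta y) = delta (prepend a y).
Proof.
case: (pselect (X y)) => [Xy|nXy]; last first.
  by rewrite !delta_out ?linear0 // => /subshift_prepend.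
rewrite op_s.unlock.
rewrite -[y]/(val (exist _ y (mem_set Xy) : X)) delta_val basis_endoE /=.
case: (pselect (X (prepend a y))) => h; first by rewrite iversonT ?scale1r.
by rewrite iversonF // scale0r delta_out.
Qed.

Lemma op_s'E a y : X y ->
  op_s' a (delta y) = iverson (y 0%N = a) *: delta (shift y).
Proof.
move=> Xy; rewrite op_s'.unlock.
by rewrite -[y]/(val (exist _ y (mem_set Xy) : X)) delta_val basis_endoE.
Qed.

Local Notation ev := (alg_eval op_gen).

Lemma ev_swE w y : ev (sw w) (delta y) = delta (wcat w y).
Proof.
elim: w => [|a w IHw]; first exact: scale1r.
by change (op_s a (ev (sw w) (delta y)) = delta (wcat (a :: w) y));
  rewrite IHw op_sE.
Qed.

Lemma ev_sw'E w y : X (wcat w y) -> ev (sw' w) (delta (wcat w y)) = delta y.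
Proof.
elim: w => [|a w IHw] Xy; first exact: scale1r.
change (ev (sw' w) (op_s' a (delta (prepend a (wcat w y)))) = delta y).
rewrite op_s'E // iversonT // scale1r shift_prepend IHw //.
exact: subshift_prepend Xy.
Qed.

Lemma ev_sw'_out w y : X y -> (forall z, y <> wcat w z) ->
  ev (sw' w) (delta y) = 0.
Proof.
elim: w y => [|a w IHw] y Xy ny; first by case: (ny y).
change (ev (sw' w) (op_s' a (delta y)) = 0).
rewrite op_s'E //.
case: (pselect (y 0%N = a)) => ya; last by rewrite iversonF // scale0r linear0.
rewrite iversonT // scale1r IHw //; first exact: subshift_shift.
by move=> z yz; apply: (ny z); rewrite /= -yz -ya prepend_shift.
Qed.

Lemma op_gen_satisfies : satisfies subshift_rel op_gen.
Proof.
move=> t u [||A B|A B|a|a|alpha beta la lb]; apply: delta_ext => y Xy.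
- change (op_p bX (delta y) = 1 *: delta y).
  by rewrite op_pE iversonT.
- change (op_p b0 (delta y) = 0 *: delta y).
  by rewrite op_pE iversonF.
- change (op_p (bI A B) (delta y) = op_p A (op_p B (delta y))).
  rewrite (op_pE (bI A B)) (op_pE B).
  case: (pselect (sval B y)) => hB; last first.
    by rewrite !iversonF ?scale0r ?linear0 // => -[].
  rewrite (iversonT hB) scale1r op_pE.
  case: (pselect (sval A y)) => hA; last by rewrite !iversonF // => -[].
  by rewrite !iversonT.
- change (op_p (bU A B) (delta y) = op_p A (delta y) + op_p B (delta y)
                  + -1 *: op_p (bI A B) (delta y)).
  rewrite (op_pE A) (op_pE B) (op_pE (bI A B)) (op_pE (bU A B)) scaleN1r.
  case: (pselect (sval A y)) => hA; case: (pselect (sval B y)) => hB.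
  + by rewrite !iversonT //; [rewrite addrK|left].
  + rewrite (iversonT hA) (iversonF hB) iversonT; last by left.
    by rewrite iversonF => [|[]//]; rewrite !scale0r oppr0 !addr0.
  + rewrite (iversonF hA) (iversonT hB) iversonT; last by right.
    by rewrite iversonF => [|[]//]; rewrite !scale0r oppr0 addr0 add0r.
  + rewrite (iversonF hA) (iversonF hB) iversonF => [|[]//].
    by rewrite iversonF => [|[]//]; rewrite !scale0r oppr0 !addr0.
- change (op_s a (op_s' a (op_s a (delta y))) = op_s a (delta y)).
  rewrite (op_sE a y).
  case: (pselect (X (prepend a y))) => h; last by rewrite delta_out // !linear0.
  by rewrite op_s'E // iversonT // scale1r op_sE.
- change (op_s' a (op_s a (op_s' a (delta y))) = op_s' a (delta y)).
  rewrite (op_s'E a Xy).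
  case: (pselect (y 0%N = a)) => ya; last first.
    by rewrite iversonF // scale0r !linear0.
  have yE : prepend a (shift y) = y by rewrite -ya prepend_shift.
  by rewrite iversonT // scale1r op_sE yE op_s'E // iversonT // scale1r.
- change (ev (sw beta) (ev (sw' alpha) (ev (sw alpha)
    (ev (sw' beta) (delta y)))) = op_p (bC la lb) (delta y)).
  rewrite op_pE.
  case: (pselect (exists z, y = wcat beta z)) => [[z yz]|nz]; last first.
    rewrite ev_sw'_out //; last by move=> z yz; apply: nz; exists z.
    rewrite !linear0 iversonF ?scale0r // => -[z [yz _ _]].
    by apply: nz; exists z.
  rewrite yz in Xy *; rewrite ev_sw'E // ev_swE.
  case: (pselect (X (wcat alpha z))) => h.
    by rewrite ev_sw'E // ev_swE iversonT ?scale1r //; exists z.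
  rewrite delta_out // !linear0 iversonF ?scale0r // => -[z'].
  by case=> /wcat_inj <-.
Qed.

Lemma subshift_pi_morphism : ualg_morphism subshift_pi.
Proof. exact: pres_lift_morphism op_gen_satisfies. Qed.

Lemma subshift_pi_gen g : subshift_pi (pres_gen subshift_rel g) = op_gen g.
Proof. exact: pres_lift_gen op_gen_satisfies. Qed.

End Representation.

(* Main.v *)
(* By p_A s_a = s_a p_{r(A,a)}, the span W of the elements s_w p_A is closed
   under products, and for every x in the algebra the right ideal generated by
   the u in W with x u in W contains 1 (split 1 = s_a s_a^* + (1 - s_a s_a^* )
   at each factor s_a^* of x). Hence pi is injective as soon as it is so on W.
   If pi kills w = sum_g s_g d_g, with d_g in the span of the p_A and supported
   on {z : g z in X}, and d_g is nonzero at z, then the coefficient of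
   pi(w) delta_z at g z must cancel, so g z = h z for another word h of the sum,
   which forces z = c^oo with c the overhang of the longer word. Then d_g is
   supported on finitely many such points, and separating them by cylinders
   gives a set {c^oo} in U, i.e. a cycle without exit.

   Conversely, if A = {c^oo}, then s_c p_A - p_A is killed by pi, but it is
   nonzero because s_c p_A and p_A have different degrees in the Z-graded
   version of pi. *)

From HB Require Import structures.
Require Import Defs.
From mathcomp Require Import all_boot all_order all_algebra.
From mathcomp Require Import all_classical.
From mathcomp Require Import finmap monalg.

Set Implicit Arguments.
Unset Strict Implicit.
Unset Printing Implicit Defensive.

Import GRing.Theory.

Local Open Scope classical_set_scope.
Local Open Scope ring_scope.

(** * Words, relative ranges and the Boolean algebra of sets *)

Section Words.
Variables (L : pointedType) (F : set (seq L)).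
Local Notation X := (subshift F).
Local Notation infword := (nat -> L).

Lemma wcat_cat (v w : seq L) (x : infword) :
  wcat (v ++ w) x = wcat v (wcat w x).
Proof. exact: foldr_cat. Qed.

Lemma wcat_lt (w : seq L) (x : infword) n :
  (n < size w)%N -> wcat w x n = nth point w n.
Proof. by elim: w n => [//|a w IHw] [|n] //= /IHw. Qed.

Lemma wcat_add (w : seq L) (x : infword) n : wcat w x (size w + n) = x n.
Proof. by elim: w. Qed.

Lemma factorS (x : infword) i n :
  Defs.factor x i n.+1 = x i :: Defs.factor x i.+1 n.
Proof.
rewrite /Defs.factor /= addn0 -[1%N]addn0 iotaDl -map_comp; congr cons.
by apply: eq_map => k /=; rewrite add1n addnS.
Qed.

Lemma factor_shift (x : infword) i n :
  Defs.factor x i.+1 n = Defs.factor (shift x) i n.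
Proof. by apply: eq_map => k. Qed.

Lemma factor_wcat (w : seq L) (x : infword) :
  Defs.factor (wcat w x) 0 (size w) = w.
Proof. by elim: w => [//|a w IHw]; rewrite factorS factor_shift IHw. Qed.

Lemma wcat_factor (x : infword) n :
  wcat (Defs.factor x 0 n) (fun k => x (n + k)%N) = x.
Proof.
elim: n x => [//|n IHn] x; rewrite factorS factor_shift -[RHS]prepend_shift /=.
by rewrite -[in RHS](IHn (shift x)).
Qed.

Lemma language_wcat (w : seq L) x : X (wcat w x) -> language F w.
Proof. by right; exists (wcat w x) => //; exists 0%N; rewrite factor_wcat. Qed.

(** The empty word is excluded because it lies in the language even when the subshift is empty.
    Shifting [x] brings the occurrence at position [i] to the front. *)
Lemma language_extend (w : seq L) : language F w -> w <> [::] ->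
  exists x, X (wcat w x).
Proof.
case=> [//|[x Xx [i ->]] _]; elim: i x Xx => [|i IHi] x Xx.
  by exists (fun k => x (size w + k)%N); rewrite wcat_factor.
by rewrite factor_shift; apply: IHi; exact: subshift_shift.
Qed.

Lemma boolalg_subshift A : in_boolalg F A -> A `<=` X.
Proof.
elim=> {A} [al be _ _ y [x [-> //]]|A B _ IHA _ IHB y [/IHA|/IHB] //||].
  by move=> A B _ IHA _ _ y [/IHA].
by move=> A _ _ y [].
Qed.

Lemma relC_nilr al : relC F al [::] = [set x | X (wcat al x)].
Proof.
apply/seteqP; split=> [y [x [-> _ //]]|y Xy]; exists y; split=> //.
exact: subshift_wcat Xy.
Qed.

(* The relative range r(A, a) of a set A contained in the subshift. *)
Definition lrange (A : set infword) (a : L) : set infword :=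
  [set x | A (prepend a x)].

Lemma boolalg_lrangeX a : in_boolalg F (lrange X a).
Proof.
case: (pselect (exists x, X (prepend a x))) => [[x Xx]|nX].
  rewrite (_ : lrange X a = relC F [:: a] [::]); last by rewrite relC_nilr.
  by apply: boolalg_C; [exact: (@language_wcat [:: a] x)|left].
rewrite (_ : lrange X a = set0); first exact: boolalg_0.
by apply/seteqP; split=> // x Xx; apply: nX; exists x.
Qed.

Lemma lrange_relC_nil al a :
  lrange (relC F al [::]) a = relC F (al ++ [:: a]) [::].
Proof.
rewrite !relC_nilr; apply/seteqP.
by split=> x; rewrite /lrange /= wcat_cat.
Qed.

Lemma lrange_relC_cons al be a :
  lrange (relC F al (a :: be)) a = relC F al be `&` lrange X a.
Proof.
apply/seteqP; split=> x.
  move=> [y [/(congr1 (@shift L))]]; rewrite !shift_prepend => -> Xy Xal.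
  by split=> //; exists y; split=> //; exact: subshift_prepend Xy.
by move=> [[y [-> _ Xal]] Xy]; exists y.
Qed.

Lemma lrange_relC_neq al be a b : a <> b ->
  lrange (relC F al (b :: be)) a = set0.
Proof.
by move=> nab; apply/seteqP; split=> // x [y [/(congr1 (@^~ 0%N)) /= /nab]].
Qed.

(** This makes $p_{r(A,a)}$ a generator. On $C(\alpha,\beta)$, pulling back along [prepend a] strips
    the first letter of $\beta$ or, if $\beta$ is empty, appends $a$ to $\alpha$. *)
Lemma boolalg_lrange A a : in_boolalg F A -> in_boolalg F (lrange A a).
Proof.
elim=> {A} [al be la lb|A B _ IHA _ IHB|A B _ IHA _ IHB|A _ IHA].
- case: be lb => [|b be] lb.
    rewrite lrange_relC_nil.
    case: (pselect (exists x, X (wcat (al ++ [:: a]) x))) => [[x Xx]|nX].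
      by apply: boolalg_C; [exact: language_wcat Xx|left].
    rewrite relC_nilr (_ : mkset _ = set0); first exact: boolalg_0.
    by apply/seteqP; split=> // x Xx; apply: nX; exists x.
  case: (pselect (a = b)) => [<-|nab]; last first.
    by rewrite lrange_relC_neq //; exact: boolalg_0.
  rewrite lrange_relC_cons; apply: boolalg_I; last exact: boolalg_lrangeX.
  apply: boolalg_C => //; case: (language_extend lb) => // x.
  by move/subshift_prepend; exact: language_wcat.
- exact: boolalg_U.
- exact: boolalg_I.
(* A complement in [X] pulls back to a complement in [lrange X a], which may be smaller than [X]. *)
rewrite (_ : lrange _ a = (X `\` lrange A a) `&` lrange X a).
  by apply: boolalg_I; [exact: boolalg_D|exact: boolalg_lrangeX].
apply/seteqP; split=> x; first by case=> Xx nA; split=> //; split=> //;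
  exact: subshift_prepend Xx.
by case=> [[_ nA] Xx].
Qed.

Lemma boolalg_eq (A B : boolalg F) : sval A = sval B -> A = B.
Proof.
case: A B => [A hA] [B hB] /= AB; case: _ / AB hB => hB.
by congr exist; exact: Prop_irrelevance.
Qed.

Definition bD (A : boolalg F) : boolalg F :=
  exist _ (X `\` sval A) (boolalg_D (svalP A)).

Definition blrange (A : boolalg F) (a : L) : boolalg F :=
  exist _ (lrange (sval A) a) (boolalg_lrange a (svalP A)).

Definition brange (A : boolalg F) (w : seq L) : boolalg F := foldl blrange A w.

Lemma brangeE A w : sval (brange A w) = [set x | sval A (wcat w x)].
Proof. by elim: w A => [//|a w IHw] A; rewrite /= IHw. Qed.

(** * Periodic points and separation by cylinders *)

Lemma wcat_period (c : seq L) (z : infword) :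
  c <> [::] -> wcat c z = z -> z = wpow c.
Proof.
move=> c0 cz; apply: funext => n; rewrite /wpow.
elim/ltn_ind: n => n IHn; case: (ltnP n (size c)) => [lt_nc|le_cn].
  by rewrite -[z in LHS]cz wcat_lt // modn_small.
rewrite -(subnKC le_cn) modnDl -[z in LHS]cz wcat_add IHn //.
by rewrite ltn_subrL (leq_trans _ le_cn) ?andbT; case: (c) c0.
Qed.

Lemma wcat_eq_drop (v w : seq L) (z : infword) : (size v <= size w)%N ->
  wcat v z = wcat w z ->
  w = v ++ drop (size v) w /\ wcat (drop (size v) w) z = z.
Proof.
elim: v w => [|a v IHv] [|b w] //= le_vw e.
have /(IHv w le_vw) [wE zE] := congr1 (@shift L) e.
by split=> //; have /= -> := congr1 (@^~ 0%N) e; rewrite -wE.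
Qed.

(* At least one of the two words being dropped from is exhausted, so that the
   concatenation is the nonempty overhang of the longer word. *)
Lemma wcat_eq_period (v w : seq L) (z : infword) : v <> w ->
  wcat v z = wcat w z ->
  let c := drop (size v) w ++ drop (size w) v in c <> [::] /\ wcat c z = z.
Proof.
wlog le_vw : v w / (size v <= size w)%N => [hwlog|nvw e /=].
  case: (leqP (size v) (size w)) => [le_vw|/ltnW le_wv] nvw e.
    exact: hwlog.
  have := hwlog w v le_wv (not_eq_sym nvw) (esym e).
  by rewrite (drop_oversize le_wv) cats0.
have [wE zE] := wcat_eq_drop le_vw e.
rewrite (drop_oversize le_vw) cats0; split=> // d0; apply: nvw.
by rewrite wE d0 cats0.
Qed.

Lemma cylinder_separates (z e : infword) : X z -> z <> e ->
  exists A, [/\ in_boolalg F A, A z & ~ A e].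
Proof.
move=> Xz ze; have [n zen] : exists n, z n <> e n.
  by apply: contrapT => h; apply: ze; apply: funext => n; apply: contrapT => ?;
    apply: h; exists n.
(* The prefix [w] reaches index [n], where [z] and [e] differ; $C(\omega,w)$ is the cylinder of
   [w]. *)
set w := Defs.factor z 0 n.+1; pose x k := z (n.+1 + k)%N.
have zw : wcat w x = z by exact: wcat_factor.
exists (relC F [::] w); split.
- by apply: boolalg_C; [left|apply: (@language_wcat w x); rewrite zw].
- exists x; rewrite zw; split=> //=.
  by apply: (@subshift_wcat _ _ w x); rewrite zw.
- move=> [y [ew _ _]]; apply: zen; rewrite -[z in LHS]zw ew.
  by rewrite !wcat_lt // size_map size_iota.
Qed.

(** Induction on [E]: if [A] has a point other than the head [e], a cylinder around that point
    removes [e]; otherwise [A] is already the singleton of [e]. *)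
Lemma boolalg_finite_singleton (E : seq infword) A :
  in_boolalg F A -> A !=set0 -> (forall z, A z -> z \in E) ->
  exists z, A z /\ in_boolalg F [set z].
Proof.
elim: E A => [|e E IHE] A hA [z0 Az0] AE; first by have := AE _ Az0.
case: (pselect (exists z, A z /\ z <> e)) => [[z [Az ze]]|nz].
  have [C [hC Cz nCe]] := cylinder_separates (boolalg_subshift hA Az) ze.
  have [||y [[Ay Cy] hy]] := IHE _ (boolalg_I hA hC).
  - by exists z.
  - move=> y [Ay Cy]; have := AE _ Ay; rewrite inE => /orP[/eqP ye|//].
    by case: nCe; rewrite -ye.
  by exists y.
have Ae z : A z -> z = e.
  by move=> Az; apply: contrapT => ze; apply: nz; exists z.
exists z0; split=> //; rewrite (_ : [set z0] = A) //.
apply/seteqP; split=> [_ -> //|z /Ae ->]; exact/esym/Ae.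
Qed.

End Words.

(** * Consequences of the defining relations *)

Section Relations.
Variables (R : comNzRingType) (L : pointedType) (F : set (seq L)).
Variables (B : ualgType R) (phi : generator F -> B).
Hypothesis phiP : satisfies (@subshift_rel R L F) phi.
Hypothesis letters : forall a, language F [:: a].

Local Notation X := (subshift F).
Local Notation p A := (phi (gen_p A)).
Local Notation s a := (phi (gen_s F a)).
Local Notation s' a := (phi (gen_s' F a)).

(* Locked to keep the rewriting rule [mulrA] from unfolding these products. *)
Definition prod_s (w : seq L) : B := locked (alg_eval phi (sw R F w)).
Definition prod_s' (w : seq L) : B := locked (alg_eval phi (sw' R F w)).
Local Notation S := prod_s.
Local Notation S' := prod_s'.

Let language0 : language F [::] := or_introl erefl.

(** The cylinder $Z_a$ and the follower set $F_a$, whose projections are $s_a s_a^*$ and $s_a^* s_a$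
    by [rel_C]. *)
Definition bZ a : boolalg F := bC language0 (letters a).
Definition bF a : boolalg F := bC (letters a) language0.

Lemma p_X : p (bX F) = 1.
Proof. by rewrite -(scal1 (s := B)); exact: phiP (rel_pX R F). Qed.

Lemma p_0 : p (b0 F) = 0.
Proof. by rewrite -(scal0 B); exact: phiP (rel_p0 R F). Qed.

Lemma p_I A C : p (bI A C) = p A * p C.
Proof. exact: phiP (rel_pI R A C). Qed.

Lemma p_U A C : p (bU A C) = p A + p C - p (bI A C).
Proof.
by have /= := phiP (rel_pU R A C); rewrite scalN1 mulN1r.
Qed.

Lemma p_set0 A : sval A = set0 -> p A = 0.
Proof. by move=> A0; rewrite -p_0; congr (p _); exact: boolalg_eq. Qed.

Lemma p_sub A C : sval A `<=` sval C -> p A * p C = p A.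
Proof.
move=> AC; rewrite -p_I; congr (p _); apply: boolalg_eq => /=.
exact/setIidPl.
Qed.

Lemma p_C A C : p A * p C = p C * p A.
Proof. by rewrite -!p_I; congr (p _); apply: boolalg_eq; rewrite /= setIC. Qed.

Lemma p_disjoint A C : sval A `&` sval C = set0 -> p A * p C = 0.
Proof. by move=> AC; rewrite -p_I; exact: p_set0. Qed.

(** Inclusion-exclusion for the disjoint union of [A] and its complement, which is [X]. *)
Lemma p_D A : p (bD A) = 1 - p A.
Proof.
have := p_U A (bD A); rewrite p_I p_disjoint ?subr0; last first.
  by rewrite /= setDE setICA setICr setI0.
move=> e; rewrite -p_X; apply/eqP; rewrite eq_sym subr_eq addrC; apply/eqP.
rewrite -e; congr (p _); apply: boolalg_eq => /=.
rewrite setDE setUIr setUCr setIT; apply/esym/setUidPr.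
exact: boolalg_subshift (svalP A).
Qed.

Lemma p_pD A : p A * p (bD A) = 0.
Proof. by rewrite p_D mulrBr mulr1 p_sub ?subrr. Qed.

Lemma S_nil : S [::] = 1. Proof. by rewrite /prod_s -lock; exact: scal1. Qed.

Lemma S_cons a w : S (a :: w) = s a * S w.
Proof. by rewrite /prod_s -!lock. Qed.

Lemma S_cat v w : S (v ++ w) = S v * S w.
Proof.
elim: v => [|a v IHv]; first by rewrite S_nil mul1r.
by rewrite cat_cons !S_cons IHv mulrA.
Qed.

Lemma S'_nil : S' [::] = 1. Proof. by rewrite /prod_s' -lock; exact: scal1. Qed.

Lemma S'_cons a w : S' (a :: w) = S' w * s' a.
Proof. by rewrite /prod_s' -!lock. Qed.

Lemma S'_cat v w : S' (v ++ w) = S' w * S' v.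
Proof.
elim: v => [|a v IHv]; first by rewrite S'_nil mulr1.
by rewrite cat_cons !S'_cons IHv mulrA.
Qed.

Lemma S1 a : S [:: a] = s a. Proof. by rewrite S_cons S_nil mulr1. Qed.
Lemma S'1 a : S' [:: a] = s' a. Proof. by rewrite S'_cons S'_nil mul1r. Qed.

Lemma p_relC al be (la : language F al) (lb : language F be) :
  p (bC la lb) = S be * S' al * S al * S' be.
Proof.
by rewrite /prod_s /prod_s' -!lock; exact/esym/(phiP (rel_C R la lb)).
Qed.

Lemma p_bZ a : p (bZ a) = s a * s' a.
Proof. by rewrite p_relC S'_nil S_nil S1 S'1 !mulr1. Qed.

Lemma p_bF a : p (bF a) = s' a * s a.
Proof. by rewrite p_relC S'_nil S_nil S1 S'1 mulr1 mul1r. Qed.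

Lemma ss's a : s a * s' a * s a = s a.
Proof. exact: phiP (rel_ss's R F a). Qed.

Lemma s'ss' a : s' a * s a * s' a = s' a.
Proof. exact: phiP (rel_s'ss' R F a). Qed.

Lemma bZ_s a : p (bZ a) * s a = s a. Proof. by rewrite p_bZ ss's. Qed.
Lemma s_bF a : s a * p (bF a) = s a. Proof. by rewrite p_bF mulrA ss's. Qed.
Lemma s'_bZ a : s' a * p (bZ a) = s' a. Proof. by rewrite p_bZ mulrA s'ss'. Qed.

Lemma bZE a : sval (bZ a) = [set x | X x /\ x 0%N = a].
Proof.
apply/seteqP; split=> x; first by case=> y [-> Xy _].
move=> [Xx <-]; exists (shift x); rewrite /= prepend_shift; split=> //.
exact: subshift_shift.
Qed.

Lemma p_s_eq0 A a : lrange (sval A) a = set0 -> p A * s a = 0.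
Proof.
move=> A0; rewrite -bZ_s mulrA p_disjoint ?mul0r // bZE.
apply/seteqP; split=> // x [Ax [_ xa]].
suff : lrange (sval A) a (shift x) by rewrite A0.
by rewrite /lrange /= -xa prepend_shift.
Qed.

Lemma p_s_relC al be a (la : language F al) (lb : language F be) C :
  sval C = lrange (relC F al be) a -> p (bC la lb) * s a = s a * p C.
Proof.
case: be lb => [|b be] lb eC.
  case: (pselect (exists x, X (wcat (al ++ [:: a]) x))) => [[x Xx]|nX].
    have la' := language_wcat Xx.
    (* With $q = s_\alpha^* s_\alpha$, inserting $s_a = s_a s_a^* s_a$ and commuting projections
       gives $q s_a = s_a (s_a^* q s_a)$, and the bracket is $p_{C(\alpha a,\omega)}$. *)
    rewrite -[s a in LHS]bZ_s mulrA p_C -mulrA p_bZ p_relC.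
    rewrite S_nil S'_nil mul1r mulr1.
    have -> : C = bC la' language0.
      by apply: boolalg_eq; rewrite eC lrange_relC_nil.
    by rewrite p_relC S_nil S'_nil mul1r mulr1 S'_cat S_cat S1 S'1 !mulrA.
  suff A0 : lrange (relC F al [::]) a = set0.
    by rewrite p_s_eq0 // (@p_set0 C) ?mulr0 // eC.
  apply/seteqP; split=> // x; rewrite lrange_relC_nil relC_nilr => Xx.
  by apply: nX; exists x.
case: (pselect (a = b)) => [ab|nab]; last first.
  by rewrite p_s_eq0 ?(@p_set0 C) ?mulr0 ?eC // lrange_relC_neq.
case: _ / ab lb eC => lb eC.
have lb' : language F be.
  case: (language_extend lb) => // x; move/subshift_prepend.
  exact: language_wcat.
have -> : C = bI (bC la lb') (bF a).
  by apply: boolalg_eq; rewrite eC lrange_relC_cons /= relC_nilr.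
by rewrite p_I p_bF !p_relC S_cons S'_cons !mulrA.
Qed.

Lemma p_s A a : p A * s a = s a * p (blrange A a).
Proof.
case: A => A hA.
(* Projections do not depend on the membership proof, so the induction on [in_boolalg] may leave the
   proof [h] inside the argument arbitrary. *)
have pE (E : set (nat -> L)) (h h' : in_boolalg F E) :
    p (exist _ E h) = p (exist _ E h') by congr (p _); exact: boolalg_eq.
have hA' := hA; elim: hA' hA => {A}
  [al be la lb|A C hA IHA hC IHC|A C hA IHA hC IHC|A hA IHA] h.
- by rewrite (pE _ _ (boolalg_C la lb)); exact: p_s_relC.
- rewrite (_ : exist _ _ h = bU (exist _ A hA) (exist _ C hC)); last first.
    exact: boolalg_eq.
  rewrite (_ : blrange _ a =
    bU (blrange (exist _ A hA) a) (blrange (exist _ C hC) a)); last first.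
    exact: boolalg_eq.
  by rewrite !p_U !p_I mulrBl mulrBr mulrDl mulrDr -mulrA !IHC mulrA IHA mulrA.
- rewrite (_ : exist _ _ h = bI (exist _ A hA) (exist _ C hC)); last first.
    exact: boolalg_eq.
  rewrite (_ : blrange _ a =
    bI (blrange (exist _ A hA) a) (blrange (exist _ C hC) a)); last first.
    exact: boolalg_eq.
  by rewrite !p_I -mulrA !IHC mulrA IHA mulrA.
rewrite (_ : exist _ _ h = bD (exist _ A hA)); last exact: boolalg_eq.
(* $r(X \setminus A, a) = F_a \cap (X \setminus r(A,a))$, and $s_a$ absorbs $p_{F_a}$. *)
rewrite (_ : blrange _ a = bI (bF a) (bD (blrange (exist _ A hA) a))).
  by rewrite p_I !p_D mulrA s_bF mulrBl mulrBr mul1r mulr1 IHA.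
apply: boolalg_eq; rewrite /= relC_nilr; apply/seteqP; split=> x.
  by case=> Xx nA; split=> //; split=> //; exact: subshift_prepend Xx.
by case=> Xx [_ nA].
Qed.

Lemma p_S A w : p A * S w = S w * p (brange A w).
Proof.
elim: w A => [|a w IHw] A; first by rewrite S_nil mulr1 mul1r.
by rewrite S_cons mulrA p_s -mulrA IHw mulrA.
Qed.

Lemma s's_neq a b : a <> b -> s' a * s b = 0.
Proof.
move=> nab; rewrite -s'_bZ -[s b]bZ_s mulrA -[_ * _ * p _]mulrA.
rewrite p_disjoint ?mulr0 ?mul0r // !bZE; apply/seteqP; split=> // x.
by case=> [[_ xa] [_ xb]]; case: nab; rewrite -xa.
Qed.

(** * Analytic elements *)

Definition analytic_term (t : R * seq L * boolalg F) : B :=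
  scal t.1.1 * (S t.1.2 * p t.2).

Lemma analytic_termE r w A :
  analytic_term (r, w, A) = scal r * (S w * p A).
Proof. by []. Qed.

(* As opposed to a general element of the algebra, no s_a^* occurs. *)
Definition analytic (x : B) := exists l, x = \sum_(t <- l) analytic_term t.

Lemma analytic0 : analytic 0.
Proof. by exists [::]; rewrite big_nil. Qed.

Lemma analyticD x y : analytic x -> analytic y -> analytic (x + y).
Proof. by move=> [l ->] [m ->]; exists (l ++ m); rewrite big_cat. Qed.

Lemma analytic_sum (I : Type) (l : seq I) (G : I -> B) :
  (forall i, analytic (G i)) -> analytic (\sum_(i <- l) G i).
Proof.
move=> hG; apply: (big_ind analytic) => [|x y|i _]; last exact: hG.
  exact: analytic0.
exact: analyticD.
Qed.

Lemma analytic_gen r w A : analytic (scal r * (S w * p A)).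
Proof. by exists [:: (r, w, A)]; rewrite big_seq1. Qed.

Lemma analytic_scal r : analytic (scal r).
Proof. by have := analytic_gen r [::] (bX F); rewrite S_nil p_X !mulr1. Qed.

Lemma analytic_p A : analytic (p A).
Proof. by have := analytic_gen 1 [::] A; rewrite scal1 S_nil !mul1r. Qed.

Lemma analytic_S w : analytic (S w).
Proof. by have := analytic_gen 1 w (bX F); rewrite scal1 p_X mulr1 mul1r. Qed.

Lemma analytic_s a : analytic (s a).
Proof. by rewrite -S1; exact: analytic_S. Qed.

(** $s_v p_A s_w p_C = s_{vw} p_{r(A,w) \cap C}$. *)
Lemma analyticM x y : analytic x -> analytic y -> analytic (x * y).
Proof.
move=> [l ->] [m ->]; rewrite mulr_suml; apply: analytic_sum => [[[r v] A]].
rewrite mulr_sumr; apply: analytic_sum => [[[r' w] C]].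
rewrite (_ : _ * _ =
  scal (r * r') * (S (v ++ w) * p (bI (brange A w) C))).
  exact: analytic_gen.
rewrite !analytic_termE scalM S_cat p_I -!mulrA; congr (_ * _).
rewrite [LHS]mulrA [LHS]mulrA -scalC -!mulrA; congr (_ * (_ * _)).
by rewrite mulrA p_S -mulrA.
Qed.

Lemma analytic_s'_S a b w : analytic (s' a * S (b :: w)).
Proof.
rewrite S_cons mulrA; case: (pselect (a = b)) => [<-|nab].
  by rewrite -p_bF; apply: analyticM; [exact: analytic_p|exact: analytic_S].
by rewrite s's_neq // mul0r; exact: analytic0.
Qed.

(** * Making arbitrary elements analytic by right multiplication *)

Definition right_ideal (K : B -> Prop) :=
  (forall u v, K u -> K v -> K (u + v)) /\ (forall u v, K u -> K (u * v)).

(* The right ideal generated by the analytic u such that x w u is analytic is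
   the whole algebra. *)
Definition locally_analytic (x : B) := forall w K,
  analytic w -> right_ideal K ->
  (forall u, analytic u -> analytic (x * w * u) -> K u) -> K 1.

Lemma analytic_locally x : analytic x -> locally_analytic x.
Proof.
move=> ax w K aw _ hK; apply: hK.
  by rewrite -(scal1 (s := B)); exact: analytic_scal.
by rewrite mulr1; exact: analyticM.
Qed.

(** After [u] serves [x], the hypothesis on [y] is applied to [w * u] and to the right ideal of all
    [v] with [u * v] in [K]; hence the quantification over [w] and [K]. *)
Lemma locally_analyticD x y :
  locally_analytic x -> locally_analytic y -> locally_analytic (x + y).
Proof.
move=> hx hy w K aw [KD KM] hK; apply: (hx w) => // u au axu.
rewrite -[u]mulr1; apply: (hy (w * u) (fun v => K (u * v))).
- exact: analyticM.
- split=> [v v'|v v'] h; first by rewrite mulrDr; exact: KD.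
  by rewrite mulrA; exact: KM.
move=> v av ayv; apply: hK; first exact: analyticM.
rewrite !mulrDl; apply: analyticD; last by move: ayv; rewrite !mulrA.
by rewrite mulrA; exact: analyticM.
Qed.

(** Once [y * w * u] is analytic, it plays the role of [w] for [x]. *)
Lemma locally_analyticM x y :
  locally_analytic x -> locally_analytic y -> locally_analytic (x * y).
Proof.
move=> hx hy w K aw [KD KM] hK; apply: (hy w) => // u au ayu.
rewrite -[u]mulr1; apply: (hx (y * w * u) (fun v => K (u * v))) => //.
  split=> [v v'|v v'] h; first by rewrite mulrDr; exact: KD.
  by rewrite mulrA; exact: KM.
move=> v av axv; apply: hK; first exact: analyticM.
by move: axv; rewrite !mulrA.
Qed.

(* [s_a^*] becomes analytic after splitting [1 = s_a s_a^* + (1 - s_a s_a^* )]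
   on its right. *)
Lemma locally_analytic_s' a : locally_analytic (s' a).
Proof.
move=> w K [l ->] [KD KM] hK.
rewrite -[1](subrK (p (bZ a))) -p_D p_bZ; apply: KD; last apply: KM.
  (* Case $u = 1 - s_a s_a^*$: terms with empty word are killed since $s_a^* = s_a^* p_{Z_a}$; in
     the others $s_a^*$ meets a letter. *)
  apply: hK; first exact: analytic_p.
  rewrite mulr_sumr mulr_suml; apply: analytic_sum => [[[r [|b v]] A]];
    rewrite analytic_termE.
    rewrite S_nil mul1r mulrA -scalC -!mulrA p_C -s'_bZ -[s' a * _ * _]mulrA.
    by rewrite [p (bZ a) * _]mulrA p_pD mul0r !mulr0; exact: analytic0.
  rewrite mulrA -scalC -!mulrA; apply: analyticM; first exact: analytic_scal.
  rewrite mulrA; apply: analyticM; first exact: analytic_s'_S.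
  by apply: analyticM; exact: analytic_p.
(* Case $u = s_a$: for the empty word, $s_a^* p_A s_a = p_{F_a} p_{r(A,a)}$. *)
apply: hK; first exact: analytic_s.
rewrite mulr_sumr mulr_suml; apply: analytic_sum => [[[r [|b v]] A]];
  rewrite !analytic_termE mulrA -scalC -!mulrA;
  apply: analyticM; try exact: analytic_scal.
  rewrite S_nil mul1r p_s mulrA -p_bF; apply: analyticM; exact: analytic_p.
rewrite mulrA; apply: analyticM; first exact: analytic_s'_S.
by apply: analyticM; [exact: analytic_p|exact: analytic_s].
Qed.

Lemma eval_locally_analytic t : locally_analytic (alg_eval phi t).
Proof.
elim: t => [[A|a|a]|r|t IHt u IHu|t IHt u IHu].
- by apply: analytic_locally; exact: analytic_p.
- by apply: analytic_locally; exact: analytic_s.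
- exact: locally_analytic_s'.
- by apply: analytic_locally; exact: analytic_scal.
- exact: locally_analyticD.
- exact: locally_analyticM.
Qed.

(** Splitting [C] successively along the sets of [l] makes the combination constant on each piece,
    with [r0] accumulating its value. If the value is 0 on every nonempty piece, the product
    vanishes; otherwise a piece serves as [D]. *)
Lemma p_comb_eq0_or (l : seq (R * boolalg F)) r0 C :
  (scal r0 + \sum_(t <- l) scal t.1 * p t.2) * p C = 0 \/
  exists D : boolalg F, [/\ sval D !=set0, sval D `<=` sval C &
    forall z, sval D z ->
      r0 + \sum_(t <- l) t.1 * iverson R (sval t.2 z) != 0].
Proof.
elim: l r0 C => [|[r A] l IHl] r0 C.
  rewrite big_nil addr0; case: (pselect (sval C !=set0)) => C0; last first.
    by left; rewrite p_set0 ?mulr0 //; apply: contrapT => /eqP/set0P.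
  have [->|r00] := eqVneq r0 0; first by left; rewrite scal0 mul0r.
  by right; exists C; split=> // z _; rewrite big_nil addr0.
have pAC : p C = p (bI A C) + p (bI (bD A) C).
  by rewrite !p_I p_D mulrBl mul1r addrC subrK.
rewrite big_cons /= pAC mulrDr.
case: (IHl (r0 + r) (bI A C)) => [e1|[D [D0 DC hD]]]; last first.
  right; exists D; split=> // [z /DC [] //|z Dz]; rewrite big_cons /=.
  by rewrite (iversonT R) ?mulr1 ?addrA; [exact: hD|case: (DC _ Dz)].
case: (IHl r0 (bI (bD A) C)) => [e2|[D [D0 DC hD]]]; last first.
  right; exists D; split=> // [z /DC [] //|z Dz]; rewrite big_cons /=.
  by rewrite (iversonF R) ?mulr0 ?add0r; [exact: hD|case: (DC _ Dz) => -[]].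
left; rewrite -[RHS]addr0; congr (_ + _).
  rewrite -[RHS]e1 scalD addrA !mulrDl; congr (_ + _ + _).
  by rewrite -mulrA (@p_C A) p_sub // => z [].
rewrite -[RHS]e2 addrCA mulrDl -mulrA p_I [p A * _]mulrA p_pD.
by rewrite mul0r mulr0 add0r.
Qed.

End Relations.

(** * The $\mathbb{Z}$-graded version of $\pi$ *)

Section GradedRepresentation.
Variables (R : comNzRingType) (L : pointedType) (F : set (seq L)).
Local Notation P := (subshift_mod R F).

(* The elements of int -> P are the (not necessarily finite) Laurent series
   with coefficients in P, and [deg_op g d] acts as g t^d. *)
Definition deg_fun (g : endo P) (d : int) (f : int -> P) : int -> P :=
  fun n => g (f (n - d)).

Fact deg_fun_linear g d : linear (deg_fun g d).
Proof. by move=> a u v; apply: funext => n; exact: linearP. Qed.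

HB.instance Definition _ g d :=
  GRing.isLinear.Build R (int -> P) (int -> P) *:%R (deg_fun g d)
    (deg_fun_linear g d).

Definition deg_op g d : endo (int -> P) :=
  deg_fun g d : {linear (int -> P) -> (int -> P)}.

Lemma deg_opE g d f n : deg_op g d f n = g (f (n - d)).
Proof. by []. Qed.

Definition graded_gen (x : generator F) : endo (int -> P) :=
  match x with
  | gen_p A => deg_op (op_p R A) 0
  | gen_s a => deg_op (op_s R F a) 1
  | gen_s' a => deg_op (op_s' R F a) (-1)
  end.

Definition homogeneous t d :=
  alg_eval graded_gen t = deg_op (alg_eval (@op_gen R L F) t) d.

Lemma homogeneous_cst a : homogeneous (TCst a) 0.
Proof.
by apply: endoP => f; apply: funext => n; rewrite deg_opE subr0.
Qed.

Lemma homogeneous_add t u d :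
  homogeneous t d -> homogeneous u d -> homogeneous (TAdd t u) d.
Proof.
move=> ht hu; rewrite /homogeneous /= ht hu.
by apply: endoP => f; apply: funext.
Qed.

Lemma homogeneous_mul t u d e :
  homogeneous t d -> homogeneous u e -> homogeneous (TMul t u) (d + e).
Proof.
move=> ht hu; rewrite /homogeneous /= ht hu.
apply: endoP => f; apply: funext => n.
by rewrite endo_mulE !deg_opE endo_mulE opprD addrA.
Qed.

Lemma homogeneous_sw w : homogeneous (sw R F w) (size w)%:Z.
Proof.
elim: w => [|a w IHw]; first exact: homogeneous_cst.
by rewrite /= -add1n PoszD; exact: homogeneous_mul.
Qed.

Lemma homogeneous_sw' w : homogeneous (sw' R F w) (- (size w)%:Z).
Proof.
elim: w => [|a w IHw]; first exact: homogeneous_cst.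
by rewrite /= -addn1 PoszD opprD; exact: homogeneous_mul.
Qed.

(** Both sides of each relation are homogeneous of a common degree, so the relation is inherited
    from the ungraded operators. *)
Lemma graded_gen_satisfies : satisfies (@subshift_rel R L F) graded_gen.
Proof.
move=> t u tu; suff [d [ht hu]] : exists d, homogeneous t d /\ homogeneous u d.
  by rewrite ht hu (op_gen_satisfies tu).
have hp A : homogeneous (TGen (gen_p A)) 0 by [].
case: tu => [||A C|A C|a|a|al be la lb].
- by exists 0; split=> //; exact: homogeneous_cst.
- by exists 0; split=> //; exact: homogeneous_cst.
- by exists 0; split=> //; rewrite -[0]addr0; exact: homogeneous_mul.
- exists 0; split=> //; apply: homogeneous_add; first exact: homogeneous_add.
  by rewrite -[0]addr0; apply: homogeneous_mul => //; exact: homogeneous_cst.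
- exists 1; split=> //; rewrite -[1 in X in homogeneous _ X](subrK 1).
  by apply: homogeneous_mul => //; exact: homogeneous_mul.
- exists (-1); split=> //; rewrite -[-1](addrK 1).
  by apply: homogeneous_mul => //; exact: homogeneous_mul.
exists 0; split=> //.
(* The degree 0 is written as $|\beta| - |\alpha| + |\alpha| - |\beta|$, one summand per factor. *)
rewrite -[0](subrr (size be)%:Z) -[X in X - _]addr0 -(addNr (size al)%:Z).
rewrite addrA; apply: homogeneous_mul; last exact: homogeneous_sw'.
apply: homogeneous_mul; last exact: homogeneous_sw.
apply: homogeneous_mul; [exact: homogeneous_sw|exact: homogeneous_sw'].
Qed.

End GradedRepresentation.

(** [T] carries no equality structure, so membership in [l] is expressed through [key]. *)
Lemma eq_sum_key (V : nmodType) (T : Type) (K : eqType) (key : T -> K)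
    (l : seq T) (f g : T -> V) :
  (forall t, key t \in map key l -> f t = g t) ->
  \sum_(t <- l) f t = \sum_(t <- l) g t.
Proof.
elim: l => [|t l IHl] fg; first by rewrite !big_nil.
rewrite !big_cons fg ?mem_head // IHl // => u ul.
by apply: fg; rewrite inE ul orbT.
Qed.

(** * Injectivity in the absence of cycles without exit *)

Section Faithfulness.
Variables (R : comNzRingType) (L : pointedType) (F : set (seq L)).
Local Notation X := (subshift F).
Local Notation pi := (@subshift_pi R L F).
Local Notation gen := (pres_gen (@subshift_rel R L F)).
Local Notation delta := (delta R F).

Lemma alg_eval_gen t : alg_eval gen t = pres_class (@subshift_rel R L F) t.
Proof.
by elim: t => //= t -> u ->; rewrite ?pres_class_add ?pres_class_mul.
Qed.

(** Lets the consequences of the relations be applied inside the universal algebra itself. *)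
Lemma pres_gen_satisfies : satisfies (@subshift_rel R L F) gen.
Proof.
by move=> t u tu; rewrite !alg_eval_gen; apply/pres_classP; exact: cong_rel.
Qed.

Lemma pi_eval t : pi (alg_eval gen t) = alg_eval (@op_gen R L F) t.
Proof.
have [piD piM pi_scal] := subshift_pi_morphism R F.
elim: t => [g|a|t IHt u IHu|t IHt u IHu] /=.
- exact: subshift_pi_gen.
- exact: pi_scal.
- by rewrite piD IHt IHu.
- by rewrite piM IHt IHu.
Qed.

Lemma pi_analytic_delta l z :
  pi (\sum_(t <- l) analytic_term gen t) (delta z) =
  \sum_(t <- l) (t.1.1 * iverson R (sval t.2 z)) *: delta (wcat t.1.2 z).
Proof.
have [piD piM pi_scal] := subshift_pi_morphism R F.
elim: l => [|[[r w] A] l IHl].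
  have pi0 : pi 0 = 0 by apply: (addrI (pi 0)); rewrite -piD !addr0.
  by rewrite !big_nil pi0.
rewrite !big_cons piD endo_addE IHl; congr (_ + _).
rewrite analytic_termE /prod_s -lock !piM pi_scal pi_eval subshift_pi_gen.
rewrite -[LHS]/(r *: alg_eval (@op_gen R L F) (sw R F w) (op_p R A (delta z))).
by rewrite op_pE linearZ /= ev_swE scalerA.
Qed.

Lemma mcoeff_delta (x : X) y : (delta y)@_x = iverson R (y = val x).
Proof.
case: (pselect (X y)) => [Xy|nXy]; last first.
  by rewrite delta_out // mcoeff0 iversonF // => yx; apply: nXy; rewrite yx;
    exact: set_valP.
rewrite -[y]/(val (exist _ y (mem_set Xy) : X)) delta_val mcoeffU /iverson.
by congr _%:R; apply: congr1; apply/eqP/asboolP => [->|/val_inj].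
Qed.

Hypothesis letters : forall a, language F [:: a].
Hypothesis no_cycle : ~ exists A c, is_cycle F A c /\ no_exit A c.

(* Finitely many periodic points forming a nonempty set of the Boolean algebra
   can be separated by cylinders, which gives a cycle without exit. *)
Lemma not_all_periodic (E : seq (seq L)) (A : boolalg F) : sval A !=set0 ->
  ~ forall z, sval A z -> exists2 c, c \in E & c <> [::] /\ wcat c z = z.
Proof.
move=> A0 hE.
have [|z [Az hz]] :=
    @boolalg_finite_singleton _ F [seq wpow c | c <- E] _ (svalP A) A0.
  move=> z /hE[c cE [c0 cz]]; rewrite (wcat_period c0 cz).
  exact: map_f.
have [c _ [c0 cz]] := hE z Az.
have Xz := boolalg_subshift (svalP A) Az.
apply: no_cycle; exists [set z], c; split; last first.
  by rewrite /no_exit -(wcat_period c0 cz).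
split=> //; first by exists z.
- by apply: (@language_wcat _ _ _ z); rewrite cz.
- by move=> _ ->; split=> //=; rewrite cz.
Qed.

Let key (t : R * seq L * boolalg F) : seq L := t.1.2.

Let keysum (l : seq (R * seq L * boolalg F)) (w : seq L) : subshift_alg R F :=
  \sum_(t <- l | t.1.2 == w) analytic_term gen t.

Lemma analytic_word_eq0 l w : pi (\sum_(t <- l) analytic_term gen t) = 0 ->
  keysum l w = 0.
Proof.
move=> pi0; have genP := pres_gen_satisfies.
pose l' := [seq (t.1.1, t.2) | t <- l & t.1.2 == w].
have -> : keysum l w =
    prod_s gen w * (\sum_(t <- l') scal t.1 * gen (gen_p t.2)).
  rewrite /keysum big_map big_filter mulr_sumr; apply: eq_bigr => t /eqP <-.
  by rewrite /analytic_term mulrA scalC -mulrA.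
(* Cutting down to $\{z : wz \in X\}$ ensures that $\delta_{wz}$ is a basis vector for every [z] in
   [D] below. *)
pose C := brange (bX F) w.
have -> : prod_s gen w = prod_s gen w * gen (gen_p C).
  by rewrite -p_S // p_X // mul1r.
have [|[D [D0 DC hD]]] := p_comb_eq0_or genP l' 0 C.
  rewrite scal0 add0r => e; rewrite -mulrA.
  suff -> : gen (gen_p C) * (\sum_(t <- l') scal t.1 * gen (gen_p t.2)) = 0.
    by rewrite mulr0.
  rewrite -[RHS]e mulr_suml mulr_sumr; apply: eq_bigr => t _.
  by rewrite mulrA -scalC -!mulrA p_C.
(* The candidate periods are the overhangs between [w] and the words of [l]. *)
case: (@not_all_periodic
  [seq drop (size w) v ++ drop (size v) w | v <- map key l] D D0) => z Dz.
have Xwz : X (wcat w z) by have := DC _ Dz; rewrite /C brangeE.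
apply: contrapT => nz; have := hD _ Dz; rewrite add0r big_map big_filter /=.
have Xz := boolalg_subshift (svalP D) Dz.
(* If no candidate is a period of [z], then $vz \neq wz$ for the other words $v$. The coefficient at
   $wz$, which is 0 by [pi0], then comes from the terms with word [w] alone, contradicting [hD]. *)
pose x : X := exist (fun y => y \in X) (wcat w z) (mem_set Xwz).
have := congr1 (fun f : endo (subshift_mod R F) => (f (delta z))@_x) pi0.
rewrite pi_analytic_delta mcoeff0 raddf_sum /= => {2}<-.
rewrite big_mkcond; apply/negP; rewrite negbK; apply/eqP.
apply: (eq_sum_key (key := key)) => t tl.
rewrite mcoeffZ mcoeff_delta /=; have [->|nt] := eqVneq t.1.2 w.
  by rewrite [X in _ * _ * X]iversonT // mulr1.
rewrite [X in _ * _ * X]iversonF ?mulr0 // => e; apply: nz.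
exists (drop (size w) t.1.2 ++ drop (size t.1.2) w).
  exact: (map_f (fun v => drop (size w) v ++ drop (size v) w)).
by apply: wcat_eq_period => //; apply/eqP; rewrite eq_sym.
Qed.

Lemma analytic_faithful x : analytic gen x -> pi x = 0 -> x = 0.
Proof.
move=> [l ->] pi0.
have -> : \sum_(t <- l) analytic_term gen t =
    \sum_(w <- undup (map key l)) keysum l w.
  rewrite /keysum (exchange_big_dep xpredT) //=.
  apply: (eq_sum_key (key := key)) => t tl.
  rewrite big_mkcond (bigD1_seq (key t)) ?undup_uniq ?mem_undup //= eqxx.
  by rewrite big1 ?addr0 // => w; rewrite eq_sym => /negPf ->.
by rewrite big1 // => w _; exact: analytic_word_eq0.
Qed.

Lemma faithful_of_no_cycle x : pi x = 0 -> x = 0.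
Proof.
have [piD piM pi_scal] := subshift_pi_morphism R F.
move=> pix; have [t xE] : exists t, x = alg_eval gen t.
  by exists (repr x); rewrite alg_eval_gen pres_repr.
have gen1 : analytic gen 1.
  rewrite -(scal1 (s := subshift_alg R F)).
  exact/analytic_scal/pres_gen_satisfies.
rewrite -[x]mulr1.
have t_loc : locally_analytic gen (alg_eval gen t).
  exact: eval_locally_analytic pres_gen_satisfies letters _.
(* The right annihilator of [x] contains each analytic [u] with [x * u] analytic, because [pi] kills
   [x * u] and is injective on analytic elements. *)
apply: (t_loc 1 (fun u => x * u = 0)) => //.
  split=> u v xu; first by move=> xv; rewrite mulrDr xu xv addr0.
  by rewrite mulrA xu mul0r.
move=> u _; rewrite mulr1 -xE => axu; apply: analytic_faithful => //.
by rewrite piM pix mul0r.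
Qed.

End Faithfulness.

(** * A cycle without exit gives a nonzero element of the kernel *)

Local Notation delta := (@delta _ _ _).

Lemma no_cycle_of_faithful (R : comNzRingType) (L : pointedType)
    (F : set (seq L)) : injective (@subshift_pi R L F) ->
  ~ exists A c, is_cycle F A c /\ no_exit A c.
Proof.
move=> pi_inj [A [c [[hA _ lc c0 Ac] Ae]]].
have Az : A (wpow c) by rewrite Ae.
have [Xz Acz] := Ac _ Az.
have cz : wcat c (wpow c) = wpow c by move: Acz; rewrite {1}Ae.
pose pA : alg_term R (generator F) := TGen (gen_p (exist _ A hA)).
pose t := TMul (sw R F c) pA.
have : pres_class (@subshift_rel R L F) t = pres_class (@subshift_rel R L F) pA.
  apply: pi_inj; rewrite -!alg_eval_gen !pi_eval.
  apply: delta_ext => y Xy.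
  rewrite -[LHS]/(alg_eval (@op_gen R L F) (sw R F c) (op_p R _ (delta y))).
  rewrite -[RHS]/(op_p R _ (delta y)) op_pE linearZ /= ev_swE.
  case: (pselect (A y)) => [|nAy].
    by rewrite {1}Ae => ->; rewrite cz.
  by rewrite (iversonF R nAy) !scale0r.
move/pres_classP/(alg_eval_cong (@graded_gen_satisfies R L F)).
rewrite (homogeneous_mul (homogeneous_sw R F c) (erefl : homogeneous pA 0)).
(* On $\delta_{c^\infty}$ placed in degree 0, $s_c p_A$ has its output in degree $|c| > 0$ and $p_A$
   in degree 0. Comparing coefficients in degree 0 gives $0 = 1$ in [R]. *)
pose f (n : int) : subshift_mod R F := if n == 0 then delta (wpow c) else 0.
pose x : subshift F := exist (fun y => y \in subshift F) _ (mem_set Xz).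
move/(congr1 (fun g : endo (int -> subshift_mod R F) => (g f 0)@_x)).
rewrite deg_opE (_ : f _ = 0); last first.
  by rewrite /f addr0 sub0r oppr_eq0; case: (c) c0.
rewrite linear0 mcoeff0.
rewrite -[alg_eval (@graded_gen R L F) pA f 0]/(op_p R _ (f (0 - 0))) subrr.
rewrite [f 0]/f eqxx op_pE mcoeffZ mcoeff_delta !iversonT // mulr1.
by move/esym/eqP; rewrite oner_eq0.
Qed.

Theorem theorem3p5 (R : comNzRingType) (L : pointedType) (F : set (seq L))
    (letters_occur : subshift F !=set0 -> forall a : L, language F [:: a]) :
  injective (@subshift_pi R L F) <->
  ~ exists (A : set (nat -> L)) (c : seq L), is_cycle F A c /\ no_exit A c.
Proof.
split; first exact: no_cycle_of_faithful.
move=> no_cycle x y pixy; have [piD _ _] := subshift_pi_morphism R F.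
(* For the empty subshift [letters_occur] gives nothing, but then $1 = p_X = p_\emptyset = 0$ and
   the algebra is zero. *)
case: (pselect (subshift F !=set0)) => [X0|X0]; last first.
  have z01 : 1 = 0 :> subshift_alg R F.
    have genP := @pres_gen_satisfies R L F; rewrite -(p_X genP) -(p_0 genP).
    congr (pres_gen _ (gen_p _)); apply: boolalg_eq => /=.
    by apply: contrapT => /eqP/set0P.
  by rewrite -[x]mulr1 -[y]mulr1 z01 !mulr0.
apply/eqP; rewrite -subr_eq0; apply/eqP.
apply: faithful_of_no_cycle => //; first exact: letters_occur.
by apply: (addIr (subshift_pi y)); rewrite -piD subrK pixy add0r.
Qed.
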